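(* Let $f:\mathbb{R}^{n+d}\to\mathbb{R}$ and $g:\mathbb{R}^{n+d}\to\mathbb{R}^m$ be convex functions ($g$ componentwise convex), and assume that the mixed-integer feasible set $\{x\in\mathbb{Z}^n\times\mathbb{R}^d\mid g(x)\le 0\}$ is non-empty, compact and contained in the domain of $f$. Further, assume that $g$ fulfills the mixed-integer Slater condition. Then $$\min\{f(x)\mid g(x)\le 0,\ x\in\mathbb{Z}^n\times\mathbb{R}^d\}$$ equals $$\max_{\alpha\in\mathbb{R},\ U\in\mathbb{R}_+^{2^n\times m}}\Big\{\alpha \ \Big|\ \exists\,\pi:\mathbb{Z}^n\times\mathbb{R}^d\to\{1,\dots,2^n\} \text{ such that } \forall x\in\mathbb{Z}^n\times\mathbb{R}^d:\ \alpha\le f(x)+U_{\pi(x)}g(x)\ \text{ or }\ 1\le U_{\pi(x)}g(x)\Big\},$$ where $U_i$ denotes the $i$-th row of $U$.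
   Context: Inequalities between vectors are componentwise, and $U_i g(x)=\sum_{j=1}^m U_{i,j}g_j(x)$. Mixed-integer Slater condition: the constraints $g(x)\le 0$ fulfill it if for every point $(z,y)\in\mathbb{Z}^n\times\mathbb{R}^d$ with $g((z,y))\le 0$ there exists $y'\in\mathbb{R}^d$ such that $g((z,y'))<0$ (all components strictly negative). *)

(* Defs.v *)
From HB Require Import structures.
From mathcomp Require Import all_boot all_order all_algebra.
From mathcomp Require Import all_classical all_reals all_analysis.
Import Order.TTheory GRing.Theory Num.Theory.
Import numFieldNormedType.Exports.

Set Implicit Arguments.
Unset Strict Implicit.
Unset Printing Implicit Defensive.

Local Open Scope classical_set_scope.
Local Open Scope ring_scope.

(* Points of R^k are row vectors and constraint values
   are column vectors. Functions are total and real-valued, so the domain of f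
   is all of R^(n+d), and it contains the feasible set by construction. *)

(* A pair (z, y) in Z^n x R^d, seen as a point of R^(n+d). *)
Definition mipoint (R : realType) (n d : nat) (p : 'rV[int]_n * 'rV[R]_d) :
    'rV[R]_(n + d) :=
  row_mx (map_mx intr p.1) p.2.

Definition convex_cvec (R : realType) (k m : nat)
    (g : 'rV[R]_k -> 'cV[R]_m) : Prop :=
  forall j : 'I_m, convex_function [set: 'rV[R]_k] (fun x => g x j 0).

Definition mifeasible (R : realType) (n d m : nat)
    (g : 'rV[R]_(n + d) -> 'cV[R]_m) : set 'rV[R]_(n + d) :=
  [set x | range (@mipoint R n d) x /\ forall j, g x j 0 <= 0].

Definition mi_slater (R : realType) (n d m : nat)
    (g : 'rV[R]_(n + d) -> 'cV[R]_m) : Prop :=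
  forall (z : 'rV[int]_n) (y : 'rV[R]_d),
    (forall j, g (mipoint (z, y)) j 0 <= 0) ->
    exists y' : 'rV[R]_d, forall j, g (mipoint (z, y')) j 0 < 0.

(* U_i g(x) *)
Definition row_aggr (R : realType) (k m N : nat) (U : 'M[R]_(N, m))
    (g : 'rV[R]_k -> 'cV[R]_m) (i : 'I_N) (x : 'rV[R]_k) : R :=
  \sum_(j < m) U i j * g x j 0.

(* The pairs (alpha, U) over which the dual maximum of alpha is taken. *)
Definition dual_feasible (R : realType) (n d m : nat)
    (f : 'rV[R]_(n + d) -> R) (g : 'rV[R]_(n + d) -> 'cV[R]_m) :
    set (R * 'M[R]_(2 ^ n, m)) :=
  [set aU : R * 'M[R]_(2 ^ n, m) | (forall i j, 0 <= aU.2 i j) /\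
    exists pi : 'rV[int]_n * 'rV[R]_d -> 'I_(2 ^ n),
      forall p : 'rV[int]_n * 'rV[R]_d,
        aU.1 <= f (mipoint p) + row_aggr aU.2 g (pi p) (mipoint p) \/
        1 <= row_aggr aU.2 g (pi p) (mipoint p)].

Definition is_min (R : realType) (A : set R) (v : R) : Prop := A v /\ lbound A v.
Definition is_max (R : realType) (A : set R) (v : R) : Prop := A v /\ ubound A v.

(* Main.v *)
Require Import Defs.
From HB Require Import structures.
From mathcomp Require Import all_boot all_order all_algebra.
From mathcomp Require Import all_classical all_reals all_analysis.
From mathcomp Require Import zify ring lra.
Import Order.TTheory GRing.Theory Num.Theory.
Import numFieldNormedType.Exports.

Local Open Scope classical_set_scope.
Local Open Scope ring_scope.

(* Let v be the primal minimum. Boundedness of the mixed-integer feasible set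
   and the Slater condition force {g <= 1} to be bounded in R^(n+d). Hence
   finitely many rows u suffice to certify, for every integer z, that each point
   of the whole fibre {z} x R^d satisfies v <= f + u g or 1 <= u g: a Lagrange
   multiplier if the fibre is feasible, a multiplier with 1 <= u g if not, and one
   multiplier for all the fibres beyond each face of a large box. The integers not
   certified by u are those where the convex function
   z |-> inf_y max (f + u g - v) (u g - 1) is negative, so by Doignon's theorem
   2^n of these rows already certify every fibre. *)

(** * Convex functions and a theorem of the alternative *)

Definition cvx_fun {R : realType} {T : lmodType R} (g : T -> R) : Prop :=
  forall x y t, 0 <= t <= 1 ->
    g (t *: x + (1 - t) *: y) <= t * g x + (1 - t) * g y.

Definition cvx_set {R : realType} {T : lmodType R} (C : set T) : Prop :=
  forall x y t, C x -> C y -> 0 <= t <= 1 -> C (t *: x + (1 - t) *: y).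

Lemma convex_function_cvx {R : realType} {T : lmodType R} (g : T -> R) :
  convex_function [set: T] g -> cvx_fun g.
Proof.
move=> gc x y t /andP[t0 t1].
have := gc (Itv01 t0 t1) x y; rewrite !in_setT => /(_ isT isT).
by [].
Qed.

Section ConvexCombinators.
Context {R : realType} {T : lmodType R}.
Implicit Types f g : T -> R.

Lemma cvx_cst (c : R) : cvx_fun (fun _ : T => c).
Proof. by move=> x y t _; lra. Qed.

Lemma cvxD f g : cvx_fun f -> cvx_fun g -> cvx_fun (fun x => f x + g x).
Proof.
move=> fc gc x y t t01; have := fc x y t t01; have := gc x y t t01; lra.
Qed.

Lemma cvxZ (a : R) f : 0 <= a -> cvx_fun f -> cvx_fun (fun x => a * f x).
Proof. by move=> a0 fc x y t t01; have := ler_wpM2l a0 (fc x y t t01); lra. Qed.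

Lemma cvx_max f g :
  cvx_fun f -> cvx_fun g -> cvx_fun (fun x => Num.max (f x) (g x)).
Proof.
move=> fc gc x y t t01; have /andP[t0 t1] := t01.
have t1' : 0 <= 1 - t by lra.
have le1 a b c e : a <= c -> b <= e -> t * a + (1 - t) * b <= t * c + (1 - t) * e.
  by move=> ? ?; apply: lerD; apply: ler_wpM2l.
rewrite ge_max; apply/andP; split.
  apply: le_trans (fc x y t t01) _; apply: le1; rewrite le_max lexx //.
apply: le_trans (gc x y t t01) _; apply: le1; rewrite le_max lexx orbT //.
Qed.

Lemma cvx_sum (I : Type) (r : seq I) (F : I -> T -> R) :
  (forall i, cvx_fun (F i)) -> cvx_fun (fun x => \sum_(i <- r) F i x).
Proof.
move=> Fc; elim: r => [|i r IH] x y t t01.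
  by rewrite !big_nil; lra.
by rewrite !big_cons; exact: (cvxD _ _ (Fc i) IH).
Qed.

(** Points with [f x < 0] bound the ratio [a / b] above by [g x / - f x], points with [g y < 0]
    bound it below by [- g y / f y]; [cross] says that these bounds are compatible, and the infimum
    of the upper ones is taken. *)
Lemma cvx_two_alt (C : set T) f g :
  cvx_set C -> cvx_fun f -> cvx_fun g ->
  (forall x, C x -> 0 <= f x \/ 0 <= g x) ->
  exists a b, [/\ 0 <= a, 0 <= b, 0 < a + b &
    forall x, C x -> 0 <= a * f x + b * g x].
Proof.
move=> Cc fc gc alt.
(* Otherwise the combination of [x] and [y] with weights [p] and [q] below makes
   both [f] and [g] negative. *)
have cross x y : C x -> C y -> f x < 0 -> g y < 0 -> f x * g y <= g x * f y.
  move=> Cx Cy fx gy; rewrite leNgt; apply/negP => lt.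
  have gx : 0 <= g x by case: (alt x Cx) => //; lra.
  have fy : 0 <= f y by case: (alt y Cy) => //; lra.
  pose p := f y - g y; pose q := g x - f x.
  have p0 : 0 < p by rewrite /p; lra.
  have q0 : 0 < q by rewrite /q; lra.
  have pq0 : 0 < p + q by rewrite addr_gt0.
  pose t := p / (p + q).
  have tE : 1 - t = q / (p + q).
    by rewrite /t; field; lra.
  have t01 : 0 <= t <= 1.
    by rewrite -(subr_ge0 t) tE /t !divr_ge0 ?ltW.
  have := alt _ (Cc x y t Cx Cy t01).
  have := fc x y t t01; have := gc x y t t01.
  rewrite tE /t.
  have -> : p / (p + q) * g x + q / (p + q) * g y = (p * g x + q * g y) / (p + q).
    by ring.
  have -> : p / (p + q) * f x + q / (p + q) * f y = (p * f x + q * f y) / (p + q).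
    by ring.
  have L1 : (p * g x + q * g y) / (p + q) < 0.
    by rewrite ltr_pdivrMr // mul0r /p /q; lra.
  have L2 : (p * f x + q * f y) / (p + q) < 0.
    by rewrite ltr_pdivrMr // mul0r /p /q; lra.
  by move=> H1 H2 [] H3; lra.
have [[x0 Cx0 fx0]|nA] := pselect (exists2 x, C x & f x < 0); last first.
  exists 1, 0; split; [lra|lra|lra|] => x Cx.
  by rewrite mul1r mul0r addr0 leNgt; apply/negP => fx; apply: nA; exists x.
pose S := [set g x / - f x | x in [set x | C x /\ f x < 0]].
have S0 : S !=set0 by exists (g x0 / - f x0), x0.
have Slb : lbound S 0.
  move=> _ [x [Cx fx] <-]; apply: divr_ge0; last by lra.
  by case: (alt x Cx) => //; lra.
have l0 : 0 <= inf S by apply: lb_le_inf.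
exists (inf S), 1; split; [by []|lra|lra|] => y Cy; rewrite mul1r.
have [fy|fy] := ltP (f y) 0.
  have : inf S <= g y / - f y by apply: ge_inf; [exists 0|exists y].
  by rewrite ler_pdivlMr; lra.
have [gy|gy] := ltP (g y) 0; last by rewrite addr_ge0 // mulr_ge0.
(* If [f y = 0], then [cross] at [x0] makes [f x0 * g y], a product of two negative numbers,
   nonpositive. *)
have fy0 : 0 < f y.
  rewrite lt_neqAle fy andbT; apply/eqP => fy0.
  have := cross x0 y Cx0 Cy fx0 gy; rewrite -fy0 mulr0 leNgt => /negP; apply.
  by rewrite nmulr_rgt0.
have : - g y / f y <= inf S.
  apply: lb_le_inf => // _ [x [Cx fx] <-].
  rewrite ler_pdivrMr // mulrAC ler_pdivlMr; last by lra.
  by have := cross x y Cx Cy fx gy; lra.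
by rewrite ler_pdivrMr //; lra.
Qed.

(** Induction on the number of functions: on the convex subset where the first one is negative, the
    others satisfy the alternative and so combine into a single [h]; the two-function case then
    joins [h] to the first. *)
Lemma cvx_alternative m (C : set T) (G : 'I_m.+1 -> T -> R) :
  cvx_set C -> (forall j, cvx_fun (G j)) ->
  (forall x, C x -> exists j, 0 <= G j x) ->
  exists u : 'I_m.+1 -> R, [/\ forall j, 0 <= u j, 0 < \sum_j u j &
    forall x, C x -> 0 <= \sum_j u j * G j x].
Proof.
elim: m C G => [|m IH] C G Cc Gc alt.
  exists (fun=> 1); split=> [j||x Cx]; rewrite ?big_ord1 ?mul1r //.
  by have [j] := alt x Cx; rewrite ord1.
pose C' := [set x | C x /\ G ord0 x < 0].
have Cc' : cvx_set C'.
  move=> x y t [Cx x0] [Cy y0] t01; split; first exact: Cc.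
  have /andP[t0 t1] := t01.
  apply: le_lt_trans (Gc ord0 x y t t01) _.
  have [->|tn0] := eqVneq t 0; first by lra.
  have : t * G ord0 x < 0 by rewrite pmulr_rlt0 // lt_neqAle eq_sym tn0.
  have : (1 - t) * G ord0 y <= 0 by apply: mulr_ge0_le0; lra.
  by lra.
have [u [u0 us uG]] : exists u : 'I_m.+1 -> R,
    [/\ forall j, 0 <= u j, 0 < \sum_j u j &
    forall x, C' x -> 0 <= \sum_j u j * G (lift ord0 j) x].
  apply: (IH C' (fun j => G (lift ord0 j)) Cc') => // x [Cx x0].
  have [j] := alt x Cx; case: (unliftP ord0 j) => [j' ->|->]; first by exists j'.
  by rewrite leNgt x0.
pose h x := \sum_j u j * G (lift ord0 j) x.
have hc : cvx_fun h by apply: cvx_sum => j; apply: cvxZ.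
have [x Cx|a [b [a0 b0 ab abP]]] := cvx_two_alt C (G ord0) h Cc (Gc ord0) hc.
  by have [x0|x0] := ltP (G ord0 x) 0; [right; apply: uG|left].
exists (fun j => if unlift ord0 j is Some j' then b * u j' else a).
split=> [j||x Cx].
- by case: unliftP => // j' _; rewrite mulr_ge0.
- rewrite big_ord_recl unlift_none.
  under eq_bigr do rewrite liftK.
  rewrite -mulr_sumr; move: b0; rewrite le_eqVlt => /predU1P[b0|b0].
    by rewrite -b0 mul0r; lra.
  by have := mulr_gt0 b0 us; lra.
- rewrite big_ord_recl unlift_none.
  under eq_bigr do rewrite liftK -mulrA.
  by rewrite -mulr_sumr; exact: abP.
Qed.

End ConvexCombinators.

(** * Integer boxes and Doignon's theorem *)

Definition int_box n M (h : {ffun 'I_n -> 'I_(M + M).+1}) : 'rV[int]_n :=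
  \row_k ((h k : nat)%:Z - M%:Z).

Lemma int_box_le n M (h : {ffun 'I_n -> 'I_(M + M).+1}) k :
  (`|int_box n M h 0%R k| <= M)%N.
Proof. by rewrite mxE; have := ltn_ord (h k); lia. Qed.

Lemma int_boxP n M (z : 'rV[int]_n) :
  (forall k, (`|z 0%R k| <= M)%N) -> exists h, z = int_box n M h.
Proof.
move=> zM; exists [ffun k => inord `|(z 0 k + M%:Z)%R|%N].
apply/rowP => k; rewrite mxE ffunE inordK; have := zM k; lia.
Qed.

(** Equal parities make [a + b] even, so its half is integral; the second clause keeps the midpoint
    in every box containing both ends. *)
Lemma int_midpoint n (a b : 'rV[int]_n) :
  (forall k, odd `|a 0%R k|%N = odd `|b 0%R k|%N) ->
  exists2 w, a + b = w + w &
    forall M, (forall k, (`|a 0%R k| <= M)%N) -> (forall k, (`|b 0%R k| <= M)%N) ->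
      forall k, (`|w 0%R k| <= M)%N.
Proof.
move=> par; exists (\row_k ((a 0%R k + b 0%R k)%R %/ 2)%Z).
  apply/rowP => k; rewrite !mxE; move: (par k).
  by move: (a 0 k) (b 0 k) => x y; clear; move: x y => x y xy; lia.
move=> M aM bM k; rewrite mxE; move: (par k) (aM k) (bM k).
by move: (a 0 k) (b 0 k) => x y; clear; lia.
Qed.

Section Doignon.
Context {R : realType} {n : nat} {I : finType}.
Variable phi : I -> 'rV[int]_n -> R.
Hypothesis phi_mid : forall i a b w,
  a + b = w + w -> phi i w + phi i w <= phi i a + phi i b.

(** One index of [r] at a time, [y i] moves to a minimiser of [phi i] over the box points strictly
    below all other levels, and [c i] rises to that minimum. Raising a level preserves the strict
    inequalities, and minimality preserves the covering of the box. *)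
Lemma doignon_levels M (S : {set I}) (x : I -> 'rV[int]_n) (r : seq I) :
  (forall i, i \in S -> forall k, (`|x i 0%R k| <= M)%N) ->
  (forall i j, i \in S -> j \in S -> i != j -> phi j (x i) < 0) ->
  (forall z, exists2 i, i \in S & 0 <= phi i z) ->
  exists (c : I -> R) (y : I -> 'rV[int]_n), [/\
    forall i, i \in S -> forall k, (`|y i 0%R k| <= M)%N,
    forall i j, i \in S -> j \in S -> i != j -> phi j (y i) < c j,
    forall z : 'rV[int]_n, (forall k, (`|z 0%R k| <= M)%N) ->
      exists2 i, i \in S & c i <= phi i z &
    forall i, i \in S -> i \in r -> phi i (y i) = c i].
Proof.
move=> xM xneg xcov; elim: r => [|i r [c [y [yM yneg ycov yr]]]].
  by exists (fun=> 0), x; split.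
have [iS|iS] := boolP (i \in S); last first.
  exists c, y; split=> // j jS; rewrite inE => /predU1P[ji|]; last exact: yr.
  by rewrite ji (negPf iS) in jS.
pose Q (h : {ffun 'I_n -> 'I_(M + M).+1}) :=
  [forall j in S, (j != i) ==> (phi j (int_box n M h) < c j)].
have [h0 yh0] := int_boxP n M (y i) (yM i iS).
have Qh0 : Q h0.
  apply/forall_inP => j jS; apply/implyP => ji.
  by rewrite -yh0; apply: yneg => //; rewrite eq_sym.
case: (arg_minP (fun h => phi i (int_box n M h)) Qh0) => h /forall_inP Qh hmin.
set z := int_box n M h in Qh hmin.
have zM k : (`|z 0%R k| <= M)%N by exact: int_box_le.
(* [z] is strictly below all other levels, so only [i] can cover it. *)
have ci : c i <= phi i z.
  have [j jS cj] := ycov z zM; have [<-//|ji] := eqVneq j i.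
  by have := implyP (Qh j jS) ji; rewrite ltNge cj.
exists (fun j => if j == i then phi i z else c j),
  (fun j => if j == i then z else y j); split.
- by move=> j jS; case: eqP => // _; exact: yM.
- move=> j l jS lS jl; have [ji|ji] := eqVneq j i; have [li|li] := eqVneq l i.
  + by rewrite ji li eqxx in jl.
  + exact: (implyP (Qh l lS) li).
  + by subst l; apply: lt_le_trans ci; apply: yneg.
  + exact: yneg.
- move=> w wM; have [h' wh'] := int_boxP n M w wM.
  have [Qh'|] := boolP (Q h').
    by exists i => //; rewrite eqxx wh'; exact: hmin.
  move=> /forall_inPn[j jS]; rewrite negb_imply -wh' -leNgt => /andP[ji cj].
  by exists j => //; rewrite (negPf ji).
- move=> j jS; rewrite inE; have [->//|ji] := eqVneq j i.
  exact: yr.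
Qed.

(* Helly-type theorem of Doignon for the sets [phi i < 0]. The levels are raised
   until each set omits exactly one chosen point, lying on its boundary; two
   chosen points of equal parity then have a midpoint in all the sets. *)
Lemma doignon : (forall z, exists i, 0 <= phi i z) ->
  exists2 S : {set I}, (#|S| <= 2 ^ n)%N &
    forall z, exists2 i, i \in S & 0 <= phi i z.
Proof.
move=> cov.
pose covers (S : {set I}) := `[< forall z, exists2 i, i \in S & 0 <= phi i z >].
have covT : covers (finset.setTfor I).
  by apply/asboolP => z; have [i] := cov z; exists i; rewrite ?in_setT.
have [S /minsetP[/asboolP Scov Smin] _] := minset_exists covT.
exists S => //; rewrite leqNgt; apply/negP => cardS.
(* By minimality of [S], deleting [i] leaves some integer point uncovered. *)
have wit i : exists z, i \in S -> forall j, j \in S -> i != j -> phi j z < 0.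
  have [iS|iS] := boolP (i \in S); last by exists 0.
  have : ~~ covers (S :\ i).
    apply/negP => /Smin; rewrite subD1set => /(_ isT) SE.
    by move: iS; rewrite -SE !inE eqxx.
  move=> /asboolPn/existsNP[z zP]; exists z => _ j jS ij.
  rewrite ltNge; apply/negP => jz; apply: zP; exists j => //.
  by rewrite !inE eq_sym ij.
have [x xP] := choice wit.
pose M := \max_i \max_k `|x i 0%R k|%N.
have xM i k : (`|x i 0%R k| <= M)%N.
  apply: leq_trans (leq_bigmax i).
  exact: (leq_bigmax (F := fun k => `|x i 0%R k|%N) k).
have [|i j iS jS|//|c [y [yM yneg ycov yr]]] :=
  doignon_levels M S x (enum I); [by []|by move=> *; apply: xP|].
(* There are [2 ^ n] parity patterns, fewer than the elements of [S]. *)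
pose par i : {ffun 'I_n -> bool} := [ffun k => odd `|y i 0%R k|%N].
have : ~~ dinjectiveb par (mem S).
  apply/negP => /dinjectiveP parI.
  have := max_card (mem (imset par (mem S))).
  by rewrite card_in_imset // card_ffun card_bool card_ord leqNgt cardS.
move=> /dinjectivePn[i iS [j]]; rewrite !inE => /andP[ji jS] eqp.
have [k|w wE wM] := int_midpoint n (y i) (y j).
  by have /ffunP/(_ k) := eqp; rewrite !ffunE.
have [|l lS] := ycov w; first by apply: wM; exact: yM.
apply/negP; rewrite -ltNge.
(* At most one of [phi l (y i)], [phi l (y j)] equals [c l], any other being smaller, so
   [phi l w < c l]. *)
have := phi_mid l _ _ _ wE.
have yl : phi l (y l) = c l by apply: yr => //; rewrite mem_enum.
have [il|il] := eqVneq i l; have [jl|jl] := eqVneq j l.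
- by move: ji; rewrite il jl eqxx.
- by have := yneg j l jS lS jl; rewrite il yl; lra.
- by have := yneg i l iS lS il; rewrite jl yl; lra.
- by have := yneg i l iS lS il; have := yneg j l jS lS jl; lra.
Qed.

End Doignon.

(** * Local bounds and continuity of convex functions *)

Lemma cvx_mean {R : realType} {T : lmodType R} (f : T -> R) k
    (x : 'I_k.+1 -> T) : cvx_fun f ->
  f (k.+1%:R^-1 *: \sum_i x i) <= k.+1%:R^-1 * \sum_i f (x i).
Proof.
move=> fc; elim: k x => [|k IH] x.
  by rewrite !big_ord1 invr1 scale1r mul1r.
rewrite [\sum_i x i]big_ord_recl [\sum_i f (x i)]big_ord_recl.
have := IH (fun i => x (lift ord0 i)).
set s := \sum_i _; set r := \sum_i _ => IHx.
pose t : R := k.+2%:R^-1.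
rewrite -/t.
have k0 : 0 < k.+1%:R :> R by rewrite ltr0Sn.
have kS : k.+2%:R = k.+1%:R + 1 :> R by rewrite -natr1.
have tE : (1 - t) * k.+1%:R^-1 = t by rewrite /t kS; field; lra.
have t0 : 0 < t by rewrite invr_gt0 ltr0Sn.
have t1 : 0 <= 1 - t by rewrite subr_ge0 invf_le1 ?ltr0Sn // kS; lra.
have -> : t *: (x ord0 + s) = t *: x ord0 + (1 - t) *: (k.+1%:R^-1 *: s).
  by rewrite scalerA tE scalerDr.
apply: le_trans (fc _ _ _ _) _; first by lra.
have := ler_wpM2l t1 IHx; rewrite mulrA tE; lra.
Qed.

Lemma cvx_line_le {R : realType} {T : lmodType R} (f : T -> R) x p (s : R) :
  cvx_fun f -> `|s| <= 1 ->
  f (x + s *: p) <= f x + `|s| * (`|f (x + p) - f x| + `|f (x - p) - f x|).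
Proof.
move=> fc; wlog s0 : p s / 0 <= s.
  move=> W s1; have [s0|s0] := leP 0 s; first exact: W.
  have := W (- p) (- s); rewrite normrN scalerN scaleNr !opprK => W'.
  rewrite [X in _ * X]addrC; by apply: W' => //; rewrite oppr_ge0 ltW.
rewrite ger0_norm // => s1.
have -> : x + s *: p = s *: (x + p) + (1 - s) *: x.
  by rewrite scalerDr scalerBl scale1r [RHS]addrC addrA subrK.
have s01 : 0 <= s <= 1 by rewrite s0.
apply: le_trans (fc _ _ _ s01) _.
have : s * (f (x + p) - f x) <= s * `|f (x + p) - f x| by rewrite ler_wpM2l ?ler_norm.
have : 0 <= s * `|f (x - p) - f x| by rewrite mulr_ge0.
by lra.
Qed.

(** [x + e] is the mean of the [N] points obtained from [x] by moving along one axis by [N] times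
    that coordinate of [e]. This reduces the bound to coordinate lines, and [N%:R * eps <= 1] keeps
    each move within a unit step. *)
Lemma cvx_local_upper {R : realType} N (f : 'rV[R]_N -> R) x : cvx_fun f ->
  exists C : R, 0 <= C /\ forall (e : 'rV[R]_N) (eps : R),
    (forall i, `|e 0 i| <= eps) -> 0 <= eps -> N%:R * eps <= 1 ->
    f (x + e) <= f x + eps * C.
Proof.
move=> fc; case: N f x fc => [|N] f x fc.
  exists 0; split=> // e eps _ _ _; rewrite mulr0 addr0.
  by rewrite [x + e]thinmx0 [x]thinmx0.
pose D i := `|f (x + 'e_i) - f x| + `|f (x - 'e_i) - f x|.
have D0 i : 0 <= D i by rewrite addr_ge0.
exists (\sum_i D i); split; first by rewrite sumr_ge0.
move=> e eps eeps eps0 Neps.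
have N0 : 0 < N.+1%:R :> R by rewrite ltr0Sn.
have -> : x + e = N.+1%:R^-1 *: \sum_i (x + (N.+1%:R * e 0 i) *: 'e_i).
  rewrite big_split /= sumr_const card_ord scalerDr -[x *+ _]scaler_nat scalerA mulVf ?gt_eqF //.
  rewrite scale1r scaler_sumr [in LHS](row_sum_delta e); congr (_ + _).
  by apply: eq_bigr => i _; rewrite scalerA mulrA mulVf ?gt_eqF // mul1r.
apply: le_trans (cvx_mean _ _ _ fc) _.
rewrite mulrC ler_pdivrMr //.
apply: (@le_trans _ _ (\sum_(i < N.+1) (f x + N.+1%:R * eps * D i))).
  apply: ler_sum => i _.
  have le1 : `|N.+1%:R * e 0 i| <= N.+1%:R * eps.
    by rewrite normrM ger0_norm ?ler_wpM2l // ltW.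
  apply: le_trans (cvx_line_le _ _ _ _ fc (le_trans le1 Neps)) _.
  by rewrite lerD2l ler_wpM2r.
rewrite big_split /= sumr_const card_ord -mulr_sumr -mulr_natr; lra.
Qed.

Lemma mx_entry_le_norm {R : realType} N (x : 'rV[R]_N) i : `|x 0 i| <= `|x|.
Proof.
rewrite [leRHS]mx_normrE; exact: (le_bigmax _ (fun ij => `|x ij.1 ij.2|) (0, i)).
Qed.

(** As [x] is the midpoint of [x + e] and [x - e], the local upper bound at [x - e] yields a lower
    bound at [x + e]. *)
Lemma cvx_continuous {R : realType} N (f : 'rV[R]_N -> R) :
  cvx_fun f -> continuous f.
Proof.
move=> fc x; have [C [C0 CP]] := cvx_local_upper N f x fc.
apply/(@cvgrPdist_le _ _ _ _ (nbhs_filter x)) => eta eta0.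
(* Gives [eps * C <= eta] and [N%:R * eps <= 1], also when [C] or [N] is zero. *)
pose eps := Num.min (eta / (C + 1)) (N.+1%:R^-1).
have eps0 : 0 < eps by rewrite lt_min divr_gt0 ?invr_gt0 ?ltr0Sn //; lra.
have epsC : eps * C <= eta.
  have : eps <= eta / (C + 1) by rewrite ge_min lexx.
  by rewrite ler_pdivlMr; lra.
have epsN : N%:R * eps <= 1.
  have : eps <= N.+1%:R^-1 by rewrite ge_min lexx orbT.
  rewrite -[_^-1]mul1r ler_pdivlMr ?ltr0Sn // -natr1; lra.
apply: filterS (nbhsx_ballx x eps eps0) => y.
rewrite -ball_normE /= distrC => /ltW xy.
have ent i : `|(y - x) 0 i| <= eps by apply: le_trans (mx_entry_le_norm _ _ _) xy.
have upper := CP (y - x) eps ent (ltW eps0) epsN.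
have lower := CP (x - y) eps (fun i => _) (ltW eps0) epsN.
have {}lower : f (x + (x - y)) <= f x + eps * C.
  by apply: lower => i; rewrite -opprB mxE normrN.
have mid : f x <= 2^-1 * f (x + (y - x)) + (1 - 2^-1) * f (x + (x - y)).
  have -> : f x = f (2^-1 *: (x + (y - x)) + (1 - 2^-1) *: (x + (x - y))).
    congr f; have -> : 1 - 2^-1 = 2^-1 :> R by lra.
    rewrite -scalerDr addrACA -(opprB x y) addrC [- _ + _]addrC subrr add0r.
    by rewrite -mulr2n -[x *+ 2]scaler_nat scalerA mulVf ?scale1r // pnatr_eq0.
  by apply: fc; lra.
move: upper mid; rewrite [x + (y - x)]addrC subrK => upper mid.
rewrite ler_norml; lra.
Qed.

(** * Dirichlet approximation and boundedness of a relaxed sublevel set *)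

Lemma dirichlet_approx (n Q : nat) : (0 < Q)%N ->
  exists2 K, (0 < K)%N & forall (R : realType) (v : 'rV[R]_n),
    exists t : nat, exists w : 'rV[int]_n,
      [/\ (0 < t)%N, (t <= K)%N &
       forall k, `|t%:R * v 0 k - (w 0 k)%:~R| <= Q%:R^-1].
Proof.
case: Q => // Q _; exists (Q.+1 ^ n)%N; first by rewrite expn_gt0.
move=> R v.
pose fr (i : nat) k : R := i%:R * v 0 k - (Num.floor (i%:R * v 0 k))%:~R.
have fr01 i k : 0 <= fr i k < 1.
  by have := floor_itv (i%:R * v 0 k); rewrite /fr intrD; lra.
(* Pigeonhole: modulo 1, one more multiple of [v] is taken than there are cubes of side
   [Q.+1%:R^-1]; two multiples in one cube differ by nearly an integer vector. *)
pose bin (i : 'I_(Q.+1 ^ n).+1) : {ffun 'I_n -> 'I_Q.+1} :=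
  [ffun k => inord (Num.truncn (Q.+1%:R * fr i k))].
have Q0 : 0 < Q.+1%:R :> R by rewrite ltr0Sn.
have binE i k : (bin i k)%:R <= Q.+1%:R * fr i k < (bin i k)%:R + 1.
  have /andP[f0 f1] := fr01 i k.
  have p0 : 0 <= Q.+1%:R * fr i k by rewrite mulr_ge0 // ltW.
  have tr := truncn_itv p0; rewrite ffunE inordK ?natr1 //.
  have /andP[le_tr _] := tr; rewrite -(ltr_nat R); apply: le_lt_trans le_tr _.
  by rewrite gtr_pMr.
have /injectivePn[i [j ij eqb]] : ~~ injectiveb bin.
  apply/injectiveP => /leq_card; rewrite card_ffun !card_ord ltnn //.
wlog ltij : i j ij eqb / (i < j)%N.
  move=> W; have [lt|lt|/val_inj e] := ltngtP i j; first exact: (W i j).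
    by apply: (W j i) => //; rewrite eq_sym.
  by rewrite e eqxx in ij.
exists (j - i)%N, (\row_k (Num.floor (j%:R * v 0 k) - Num.floor (i%:R * v 0 k))).
split; first by rewrite subn_gt0.
  by apply: leq_trans (leq_subr _ _) _; rewrite -ltnS.
move=> k; rewrite mxE natrB ?(ltnW ltij) // intrB.
have -> : (j%:R - i%:R) * v 0 k -
  ((Num.floor (j%:R * v 0 k))%:~R - (Num.floor (i%:R * v 0 k))%:~R) = fr j k - fr i k.
  by rewrite /fr; ring.
rewrite -[_^-1]mul1r ler_pdivlMr // -[X in _ * X](ger0_norm (ltW Q0)) -normrM.
have := binE i k; have := binE j k; rewrite eqb ler_norml; lra.
Qed.

Lemma cvx_neg_nbhs {R : realType} N (I : finType) (F : I -> 'rV[R]_N -> R) x :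
  (forall i, cvx_fun (F i)) -> (forall i, F i x < 0) ->
  exists delta eps, [/\ 0 < delta, 0 < eps &
    forall e : 'rV[R]_N, (forall k, `|e 0 k| <= eps) -> forall i, F i (x + e) <= - delta].
Proof.
move=> Fc Fx.
have [C CP] := choice (fun i => cvx_local_upper N (F i) x (Fc i)).
have C0 i : 0 <= C i by case: (CP i).
pose delta := \big[Num.min/1]_i (- F i x).
have delta0 : 0 < delta.
  by apply: lt_bigmin => // i _; rewrite oppr_gt0.
have deltaF i : F i x <= - delta.
  by rewrite lerNr; apply: bigmin_le.
pose S := \sum_i C i.
have CS i : C i <= S by rewrite /S (bigD1 i) //= lerDl sumr_ge0.
have S0 : 0 <= S by apply: sumr_ge0.
pose eps := Num.min (delta / 2 / (S + 1)) (N.+1%:R^-1).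
have eps0 : 0 < eps by rewrite lt_min !divr_gt0 ?invr_gt0 ?ltr0Sn //; lra.
have epsN : N%:R * eps <= 1.
  have : eps <= N.+1%:R^-1 by rewrite ge_min lexx orbT.
  rewrite -[_^-1]mul1r ler_pdivlMr ?ltr0Sn // -natr1; lra.
exists (delta / 2), eps; split=> // [|e eeps i]; first by lra.
have [_ /(_ e eps eeps (ltW eps0) epsN)] := CP i.
have : eps * C i <= delta / 2.
  apply: (@le_trans _ _ (eps * (S + 1))).
    by rewrite ler_wpM2l ?ltW //; have := CS i; lra.
  by rewrite -ler_pdivlMr ?ge_min ?lexx //; lra.
have := deltaF i; lra.
Qed.

(* A far point [x] with [g x <= 1] spans, with a ball around [p0], a long cone in
   [g <= 0]; by Dirichlet approximation it contains far mixed-integer points. *)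
Lemma mi_sublevel_bounded {R : realType} n d m
    (g : 'rV[R]_(n + d) -> 'cV[R]_m) p0 B :
  (forall j, cvx_fun (fun x => g x j 0)) ->
  (forall j, g (mipoint p0) j 0 < 0) ->
  (forall p, (forall j, g (mipoint p) j 0 <= 0) ->
     forall i, `|mipoint p 0 i| <= B) ->
  exists M, forall x : 'rV[R]_(n + d), (forall j, g x j 0 <= 1) -> forall i, `|x 0 i| <= M.
Proof.
move=> gc g0 gB.
have [delta [eps [delta0 eps0 nb]]] :=
  cvx_neg_nbhs (n + d) _ (fun j x => g x j 0) (mipoint p0) gc g0.
pose Q := (Num.truncn (2 / eps)).+1.
have QE : Q%:R^-1 <= eps / 2.
  rewrite -[_^-1]mul1r ler_pdivrMr ?ltr0Sn // mulrC -ler_pdivrMr; last by lra.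
  rewrite invf_div mul1r; apply: ltW; rewrite /Q; apply: truncnS_gt.
have [K K0 dir] := dirichlet_approx n Q isT.
have K0' : 0 < K%:R :> R by rewrite ltr0n.
(* For [s <= tau], the first bound keeps [(1 - s)^-1 *: e] within [eps], the second gives
   [s - (1 - s) * delta <= 0]. *)
pose tau := Num.min (2^-1) (delta / (1 + delta)).
have tau0 : 0 < tau by rewrite lt_min divr_gt0 //; lra.
have tau2 : tau <= 2^-1 by rewrite ge_min lexx.
have taud : tau * (1 + delta) <= delta.
  by rewrite -ler_pdivlMr ?ge_min ?lexx ?orbT //; lra.
pose x0 := mipoint p0.
pose B' := B + `|x0| + eps.
exists (`|x0| + B' / (tau / K%:R)) => x gx i.
pose v := x - x0.
(* Scaling by [tau / K%:R] puts the step length [s] between [tau / K%:R] and [tau]; the lower end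
   does not depend on [x], since [K] does not. *)
have [t [w [t0 tK wP]]] := dir R (tau / K%:R *: lsubmx v).
pose s : R := t%:R * (tau / K%:R).
have s0 : tau / K%:R <= s.
  by rewrite /s ler_peMl ?ler1n // divr_ge0 ?ltW.
have tK0 : 0 < tau / K%:R by rewrite divr_gt0.
have sgt0 : 0 < s by apply: lt_le_trans s0.
have stau : s <= tau.
  by rewrite /s mulrCA ger_pMr // ler_pdivrMr // mul1r ler_nat.
pose e : 'rV[R]_(n + d) := row_mx (map_mx intr w - s *: lsubmx v) 0.
have eQ k : `|e 0 k| <= Q%:R^-1.
  rewrite /e mxE; case: splitP => k' _; last by rewrite mxE normr0 invr_ge0.
  have := wP k'; rewrite !mxE distrC mulrA; exact.
have eeps k : `|e 0 k| <= eps by apply: le_trans (eQ k) _; lra.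
pose p : 'rV[int]_n * 'rV[R]_d := (p0.1 + w, p0.2 + s *: rsubmx v).
have pE : mipoint p = x0 + s *: v + e.
  have -> : s *: v = row_mx (s *: lsubmx v) (s *: rsubmx v).
    by rewrite -scale_row_mx hsubmxK.
  rewrite /x0 /mipoint /p /e /= map_mxD !add_row_mx addr0.
  by rewrite addrACA subrr addr0.
have gp j : g (mipoint p) j 0 <= 0.
  have s1 : 0 < 1 - s by lra.
  (* The rounding error is absorbed at [x0], around which [g <= - delta] on a whole ball; this
     outweighs [g x <= 1]. *)
  have -> : mipoint p = s *: x + (1 - s) *: (x0 + (1 - s)^-1 *: e).
    rewrite pE [(1 - s) *: _]scalerDr scalerA mulfV ?gt_eqF // scale1r addrA; congr (_ + _).
    by rewrite /v scalerBr scalerBl scale1r addrCA.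
  apply: le_trans (gc j _ _ _ _) _; first by lra.
  have gd : g (x0 + (1 - s)^-1 *: e) j 0 <= - delta.
    apply: nb => k; rewrite mxE normrM gtr0_norm ?invr_gt0 //.
    rewrite mulrC ler_pdivrMr //; apply: le_trans (eQ k) _; apply: le_trans QE _.
    by rewrite ler_pM2l //; lra.
  have h1 : s * g x j 0 <= s by rewrite ger_pMr.
  have h2 : (1 - s) * g (x0 + (1 - s)^-1 *: e) j 0 <= (1 - s) * - delta.
    by rewrite ler_pM2l.
  have h3 : s * (1 + delta) <= tau * (1 + delta) by rewrite ler_wpM2r //; lra.
  by lra.
have sv : s * `|v 0 i| <= B'.
  have vE : s * v 0 i = mipoint p 0 i - x0 0 i - e 0 i.
    rewrite pE [in RHS]mxE [in RHS]mxE [(s *: v) _ _]mxE; ring.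
  have -> : s * `|v 0 i| = `|s * v 0 i| by rewrite normrM gtr0_norm.
  rewrite vE; apply: le_trans (ler_normB _ _) _; rewrite /B' lerD //.
  by apply: le_trans (ler_normB _ _) _; rewrite lerD ?gB ?mx_entry_le_norm.
have vB : `|v 0 i| <= B' / (tau / K%:R).
  rewrite ler_pdivlMr // mulrC; apply: le_trans sv; exact: ler_wpM2r.
have -> : x = x0 + v by rewrite addrC subrK.
rewrite mxE; apply: le_trans (ler_normD _ _) _.
by rewrite lerD // mx_entry_le_norm.
Qed.

(** * Multipliers on a convex set *)

Lemma cvx_row_ge1 {R : realType} {T : lmodType R} m (C : set T)
    (G : 'I_m -> T -> R) eps :
  cvx_set C -> C !=set0 -> (forall j, cvx_fun (G j)) -> 0 < eps ->
  (forall x, C x -> exists j, eps <= G j x) ->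
  exists2 u : 'I_m -> R, forall j, 0 <= u j &
    forall x, C x -> 1 <= \sum_j u j * G j x.
Proof.
case: m G => [|m] G Cc [x0 Cx0] Gc eps0 alt; first by have [[]] := alt x0 Cx0.
have [j|x Cx|u [u0 us uG]] := cvx_alternative m C (fun j x => G j x + - eps) Cc.
- by apply: cvxD => //; exact: cvx_cst.
- by have [j] := alt x Cx; exists j; rewrite subr_ge0.
(* The shifted alternative says [s <= \sum_j u j * G j x]; dividing by [s] normalises the bound to
   1. *)
pose s := (\sum_j u j) * eps.
have s0 : 0 < s by rewrite mulr_gt0.
exists (fun j => u j / s) => [j|x Cx]; first by rewrite divr_ge0 // ltW.
under eq_bigr do rewrite mulrAC.
rewrite -mulr_suml ler_pdivlMr // mul1r -subr_ge0 /s mulr_suml -sumrB.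
by under eq_bigr do rewrite -mulrBr; exact: uG.
Qed.

(** The alternative is applied to [f - v] together with the constraints. At the Slater point a zero
    weight on [f - v] would make the combination negative, so one can divide by that weight. *)
Lemma cvx_slater_multiplier {R : realType} {T : lmodType R} m (C : set T)
    (f : T -> R) (G : 'I_m -> T -> R) v x0 :
  cvx_set C -> cvx_fun f -> (forall j, cvx_fun (G j)) ->
  C x0 -> (forall j, G j x0 < 0) ->
  (forall x, C x -> (forall j, G j x <= 0) -> v <= f x) ->
  exists2 u : 'I_m -> R, forall j, 0 <= u j &
    forall x, C x -> v <= f x + \sum_j u j * G j x.
Proof.
move=> Cc fc Gc Cx0 Gx0 fv.
pose H (j : 'I_m.+1) x := if unlift ord0 j is Some j' then G j' x else f x + - v.
have H0 x : H ord0 x = f x - v by rewrite /H unlift_none.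
have HS j x : H (lift ord0 j) x = G j x by rewrite /H liftK.
have [j|x Cx|u [u0 us uH]] := cvx_alternative m C H Cc.
- rewrite /H; case: unlift => [j'|]; first exact: Gc.
  by apply: cvxD => //; exact: cvx_cst.
- have [[j Gj]|nG] := pselect (exists j, 0 <= G j x).
    by exists (lift ord0 j); rewrite HS.
  exists ord0; rewrite H0 subr_ge0; apply: fv => // j.
  by rewrite leNgt; apply/negP => Gj; apply: nG; exists j; exact: ltW.
have {}uH x : C x -> 0 <= u ord0 * (f x - v) + \sum_j u (lift ord0 j) * G j x.
  move=> Cx; have := uH x Cx; rewrite big_ord_recl H0.
  by under eq_bigr do rewrite HS.
have ua : 0 < u ord0.
  rewrite lt_neqAle u0 andbT eq_sym; apply/eqP => ua0.
  move: us; rewrite big_ord_recl ua0 add0r => us.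
  have := uH x0 Cx0; rewrite ua0 mul0r add0r leNgt => /negP; apply.
  have [/existsP[j uj]|] := boolP [exists j, 0 < u (lift ord0 j)].
    rewrite (bigD1 j) //=; apply: ltr_wnDr; last by rewrite pmulr_rlt0.
    by apply: sumr_le0 => k _; rewrite mulr_ge0_le0 // ltW.
  rewrite negb_exists => /forallP u_le0; move: us; rewrite big1 ?ltxx // => j _.
  by apply/eqP; rewrite eq_le u0 andbT leNgt.
exists (fun j => u (lift ord0 j) / u ord0) => [j|x Cx]; first by rewrite divr_ge0.
under eq_bigr do rewrite mulrAC.
rewrite -mulr_suml -lerBlDl ler_pdivlMr // mulrC.
by have := uH x Cx; lra.
Qed.

(** * Fibres over integer points and infima along them *)

Section Fibres.
Context {R : realType} {n d : nat}.

Definition mifibre (z : 'rV[int]_n) : set 'rV[R]_(n + d) :=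
  [set mipoint (z, y) | y in [set: 'rV[R]_d]].

Lemma mipoint_fibre (z : 'rV[int]_n) (x y : 'rV[R]_d) (t : R) :
  t *: mipoint (z, x) + (1 - t) *: mipoint (z, y) =
  mipoint (z, t *: x + (1 - t) *: y).
Proof.
rewrite /mipoint /= !scale_row_mx add_row_mx -scalerDl.
by rewrite [t + _]addrC subrK scale1r.
Qed.

Lemma cvx_mifibre z : cvx_set (mifibre z).
Proof.
move=> _ _ t [x _ <-] [y _ <-] _.
by exists (t *: x + (1 - t) *: y) => //; rewrite mipoint_fibre.
Qed.

Lemma cvx_fun_fibre z (f : 'rV[R]_(n + d) -> R) :
  cvx_fun f -> cvx_fun (fun y => f (mipoint (z, y))).
Proof. by move=> fc x y t t01; rewrite -mipoint_fibre; exact: fc. Qed.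

(** Compactness prevents the violation from tending to zero along the fibre: where all components
    are at most 1, the total violation [h] attains a positive minimum; elsewhere some component
    exceeds 1. *)
Lemma infeasible_fibre_gap m (g : 'rV[R]_(n + d) -> 'cV[R]_m) M z :
  (forall j, cvx_fun (fun x => g x j 0)) ->
  (forall x : 'rV[R]_(n + d),
    (forall j, g x j 0 <= 1) -> forall i, `|x 0 i| <= M) ->
  (forall y, ~ forall j, g (mipoint (z, y)) j 0 <= 0) ->
  exists2 eps, 0 < eps &
    forall x, mifibre z x -> exists j, eps <= g x j 0.
Proof.
move=> gc gM nfeas.
pose G j y := g (mipoint (z, y)) j 0.
have Gc j : cvx_fun (G j) by exact: (cvx_fun_fibre z _ (gc j)).
pose h y := \sum_j Num.max (G j y) 0.
have hc : cvx_fun h by apply: cvx_sum => j; apply: cvx_max => //; exact: cvx_cst.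
have h0 y : 0 < h y.
  have /existsNP[j /negP] := nfeas y; rewrite -ltNge => Gj.
  rewrite /h (bigD1 j) //=; apply: ltr_wpDr.
    by apply: sumr_ge0 => k _; rewrite le_max lexx orbT.
  by rewrite lt_max Gj.
pose D : set 'rV[R]_d := [set y | forall j, G j y <= 1].
have [D0|/set0P/negP/negPn/eqP D0] := pselect (D !=set0); last first.
  exists 1 => // _ [y _ <-].
  have /existsNP[j /negP] : ~ D y by rewrite D0.
  by rewrite -ltNge => Gj; exists j; exact: ltW.
have Dcl : closed D.
  have -> : D = \bigcap_j (G j @^-1` [set x | x <= 1]).
    by apply/seteqP; split=> y Dy; [move=> j _; exact: Dy|move=> j; exact: Dy].
  apply: closed_bigI => j _.
  by move/continuous_closedP: (cvx_continuous _ _ (Gc j)); apply; exact: closed_le.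
have Dbd : bounded_set D.
  exists `|M|; split=> [|B MB y Dy /=]; first exact: num_real.
  rewrite [leLHS]mx_normrE; apply: bigmax_le => [|[i k] _ /=].
    exact: le_trans (normr_ge0 M) (ltW MB).
  rewrite ord1; have := gM _ Dy (rshift n k).
  rewrite /mipoint row_mxEr /= => /le_trans; apply.
  exact: le_trans (ler_norm M) (ltW MB).
have [|c _ cmin] := @EVT_min_rV _ _ h D D0 (bounded_closed_compact Dbd Dcl).
  by apply: continuous_subspaceT; exact: cvx_continuous.
(* If all components were below [eps], then [h y] would be at most [m%:R * eps], which is less than
   [m.+1%:R * eps <= h c]. *)
pose eps := Num.min 1 (h c / m.+1%:R).
have eps0 : 0 < eps by rewrite lt_min ltr01 divr_gt0 // ltr0Sn.
exists eps => // _ [y _ <-].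
apply: contrapT => nj.
have Gj j : G j y < eps by rewrite ltNge; apply/negP => Gj; apply: nj; exists j.
have Dy : D y.
  by move=> j; apply: le_trans (ltW (Gj j)) _; rewrite ge_min lexx.
have := cmin y; rewrite inE => /(_ Dy); rewrite leNgt => /negP; apply.
apply: (@le_lt_trans _ _ (\sum_(j < m) eps)).
  by apply: ler_sum => j _; rewrite ge_max !ltW.
rewrite sumr_const card_ord -mulr_natr.
apply: (@lt_le_trans _ _ (eps * m.+1%:R)); first by rewrite ltr_pM2l // ltr_nat.
by rewrite -ler_pdivlMr ?ltr0Sn // ge_min lexx orbT.
Qed.

(** Partial minimisation over the continuous variables. [inf] is the true infimum only for [psi]
    bounded below on the fibre, whence the bound [b] in what follows. *)
Definition fibre_inf (psi : 'rV[R]_(n + d) -> R) (z : 'rV[int]_n) : R :=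
  inf [set psi x | x in mifibre z].

Section FibreInf.
Variable psi : 'rV[R]_(n + d) -> R.
Hypothesis psi_cvx : cvx_fun psi.
Variable b : R.
Hypothesis psi_ge : forall x, b <= psi x.

Let fibre_image_neq0 z : [set psi x | x in mifibre z] !=set0.
Proof. by exists (psi (mipoint (z, 0))), (mipoint (z, 0)) => //; exists 0. Qed.

Let fibre_inf_le z x : mifibre z x -> fibre_inf psi z <= psi x.
Proof. by move=> zx; apply: ge_inf; [exists b => _ [? _ <-]|exists x]. Qed.

Lemma fibre_inf_ge z c :
  (forall x, mifibre z x -> c <= psi x) <-> c <= fibre_inf psi z.
Proof.
split=> [cP|cz x zx]; last by apply: le_trans cz _; exact: fibre_inf_le.
by apply: lb_le_inf => // _ [x zx <-]; exact: cP.
Qed.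

(** The midpoint of a point over [z1] and one over [z2] lies over [w]. This is the form of convexity
    that [doignon] asks for. *)
Lemma fibre_inf_midconvex z1 z2 w : z1 + z2 = w + w ->
  fibre_inf psi w + fibre_inf psi w <= fibre_inf psi z1 + fibre_inf psi z2.
Proof.
move=> wE; rewrite -lerBlDr.
apply/fibre_inf_ge => x1 [y1 _ <-]; rewrite lerBlDr -lerBlDl.
apply/fibre_inf_ge => x2 [y2 _ <-]; rewrite lerBlDl.
have mid : mifibre w
    (2^-1 *: mipoint (z1, y1) + (1 - 2^-1) *: mipoint (z2, y2)).
  exists (2^-1 *: y1 + (1 - 2^-1) *: y2) => //.
  rewrite /mipoint /= !scale_row_mx add_row_mx; congr row_mx.
  apply/rowP => k; rewrite !mxE.
  have /rowP/(_ k) := wE; rewrite !mxE => /(congr1 (fun i : int => i%:~R : R)).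
  rewrite !intrD; lra.
have := fibre_inf_le _ _ mid.
have half : 0 <= (2^-1 : R) <= 1 by lra.
have := psi_cvx (mipoint (z1, y1)) (mipoint (z2, y2)) _ half.
lra.
Qed.

End FibreInf.
End Fibres.

(** * Finitely many certificates for all fibres *)

Section FibreCertificates.
Context {R : realType} {n d m : nat}.
Variables (f : 'rV[R]_(n + d) -> R) (g : 'rV[R]_(n + d) -> 'cV[R]_m).
Hypothesis f_cvx : cvx_fun f.
Hypothesis g_cvx : forall j, cvx_fun (fun x => g x j 0).
Variable v : R.

Let aggr (u : 'I_m -> R) x := \sum_j u j * g x j 0.

Definition certifies (u : 'I_m -> R) (z : 'rV[int]_n) : Prop :=
  forall x, mifibre z x -> v <= f x + aggr u x \/ 1 <= aggr u x.

(* The truncation at -1 keeps the infimum over a fibre finite. *)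
Definition certificate_fun (u : 'I_m -> R) x : R :=
  Num.max (Num.max (f x + aggr u x + - v) (aggr u x + - 1)) (- 1).

Lemma certificate_fun_cvx u : (forall j, 0 <= u j) -> cvx_fun (certificate_fun u).
Proof.
move=> u0.
have ac : cvx_fun (aggr u) by apply: cvx_sum => j; exact: cvxZ.
apply: cvx_max (cvx_cst _); apply: cvx_max.
  by apply: cvxD (cvx_cst _); exact: cvxD.
exact: cvxD (cvx_cst _).
Qed.

(** The non-strict bound 0 passes between [certificate_fun u] and its infimum, attained or not, and
    truncating at -1 does not affect which values are nonnegative. *)
Lemma certifiesP u z :
  certifies u z <-> 0 <= fibre_inf (certificate_fun u) z.
Proof.
have lb x : - 1 <= certificate_fun u x by rewrite /certificate_fun le_max lexx orbT.
have pos x : (0 <= certificate_fun u x) =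
    (v <= f x + aggr u x) || (1 <= aggr u x).
  by rewrite /certificate_fun !le_max !subr_ge0 oppr_ge0 ler10 orbF.
rewrite -(fibre_inf_ge _ (-1) lb); split=> H x zx.
  by rewrite pos; apply/orP; exact: H.
by apply/orP; rewrite -pos; exact: H.
Qed.

Lemma feasible_fibre_certificate z :
  (exists y, forall j, g (mipoint (z, y)) j 0 < 0) ->
  (forall x, mifibre z x -> (forall j, g x j 0 <= 0) -> v <= f x) ->
  exists2 u, forall j, 0 <= u j & certifies u z.
Proof.
move=> [y gy] fv.
have [] := cvx_slater_multiplier m (mifibre z) f (fun j x => g x j 0) v
  (mipoint (z, y)) (cvx_mifibre z) f_cvx g_cvx _ gy fv; first by exists y.
by move=> u u0 uP; exists u => // x zx; left; exact: uP.
Qed.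

Lemma infeasible_fibre_certificate M z :
  (forall x : 'rV[R]_(n + d),
    (forall j, g x j 0 <= 1) -> forall i, `|x 0 i| <= M) ->
  (forall y, ~ forall j, g (mipoint (z, y)) j 0 <= 0) ->
  exists2 u, forall j, 0 <= u j & certifies u z.
Proof.
move=> gM nfeas.
have [eps eps0 gap] := infeasible_fibre_gap m g M z g_cvx gM nfeas.
have [|u u0 uP] := cvx_row_ge1 m _ _ eps (cvx_mifibre z) _ g_cvx eps0 gap.
  by exists (mipoint (z, 0)), 0.
by exists u => // x zx; right; exact: uP.
Qed.

(** Every point of the half-space beyond a face violates some [g x j 0 <= 1], so one multiplier
    built on this convex half-space serves all the fibres in it. *)
Lemma face_certificate (M : nat) (k : 'I_n) (b : bool) :
  (forall x : 'rV[R]_(n + d),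
    (forall j, g x j 0 <= 1) -> forall i, `|x 0 i| <= M%:R) ->
  exists2 u, forall j, 0 <= u j &
    forall z : 'rV[int]_n, M%:Z < (-1) ^+ b * z 0 k -> certifies u z.
Proof.
move=> gM.
pose C : set 'rV[R]_(n + d) :=
  [set x | M%:R + 1 <= (-1) ^+ b * x 0 (lshift d k)].
have Cc : cvx_set C.
  move=> x y t; rewrite /C /= !mxE => Cx Cy /andP[t0 t1].
  have t1' : 0 <= 1 - t by lra.
  by have := ler_wpM2l t0 Cx; have := ler_wpM2l t1' Cy; lra.
have C0 : C !=set0.
  exists (const_mx ((-1) ^+ b * (M%:R + 1))).
  by rewrite /C /= mxE mulrA -signr_addb addbb mul1r.
have gap x : C x -> exists j, 1 <= g x j 0.
  move=> Cx; apply: contrapT => nj.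
  have g1 j : g x j 0 <= 1.
    by rewrite leNgt; apply/negP => gj; apply: nj; exists j; exact: ltW.
  have := gM x g1 (lshift d k); rewrite -[`|_|](normrMsign b) => le_M.
  by have := ler_norm ((-1) ^+ b * x 0 (lshift d k)); move: Cx; rewrite /C /=; lra.
have [u u0 uP] := cvx_row_ge1 m C _ 1 Cc C0 g_cvx ltr01 gap.
exists u => // z zk _ [y _ <-]; right; apply: uP.
rewrite /C /mipoint /= row_mxEl mxE.
(* Integrality improves the strict bound by [M] to the bound [M + 1] defining [C]. *)
have : (M%:Z + 1)%:~R <= ((-1) ^+ b * z 0 k)%:~R :> R by rewrite ler_int lezD1.
by rewrite intrD intrM rmorphXn /= rmorphN1.
Qed.

Lemma finite_certificates (M : nat) :
  (forall x : 'rV[R]_(n + d),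
    (forall j, g x j 0 <= 1) -> forall i, `|x 0 i| <= M%:R) ->
  (forall z y, (forall j, g (mipoint (z, y)) j 0 <= 0) ->
    exists y', forall j, g (mipoint (z, y')) j 0 < 0) ->
  (forall p, (forall j, g (mipoint p) j 0 <= 0) -> v <= f (mipoint p)) ->
  exists (I : finType) (u : I -> 'I_m -> R),
    (forall i j, 0 <= u i j) /\ forall z, exists i, certifies (u i) z.
Proof.
move=> gM slater fv.
(* One index for each face of the box and one for each integer point inside it. *)
pose I := (('I_n * bool) + {ffun 'I_n -> 'I_(M + M).+1})%type.
pose target (i : I) (z : 'rV[int]_n) : Prop :=
  match i with
  | inl kb => M%:Z < (-1) ^+ kb.2 * z 0 kb.1
  | inr h => z = int_box n M h
  end.
have ex (i : I) : exists u : 'I_m -> R, (forall j, 0 <= u j) /\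
    forall z, target i z -> certifies u z.
  case: i => [[k b]|h].
    by have [u u0 uP] := face_certificate M k b gM; exists u.
  set z := int_box n M h.
  have [u u0 uP] : exists2 u : 'I_m -> R, forall j, 0 <= u j & certifies u z.
    have [[y gy]|nfeas] := pselect (exists y, forall j, g (mipoint (z, y)) j 0 <= 0).
      apply: feasible_fibre_certificate; first exact: slater gy.
      by move=> _ [y' _ <-]; exact: fv.
    apply: (infeasible_fibre_certificate M%:R) => // y gy.
    by apply: nfeas; exists y.
  by exists u; split=> // _ ->.
have [u uP] := choice ex.
exists I, u; split=> [i|z]; first by have [] := uP i.
have [zM|] := boolP [forall k, (`|z 0%R k| <= M)%N].
  have [h ->] := int_boxP n M z (fun k => forallP zM k).
  by exists (inr h); have [_] := uP (inr h); exact.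
rewrite negb_forall => /existsP[k]; rewrite -ltnNge => zk.
exists (inl (k, z 0 k < 0)); have [_] := uP (inl (k, z 0 k < 0)); apply => /=.
by rewrite -normrEsign -abszE ltz_nat.
Qed.

End FibreCertificates.

(** * Weak duality, attainment and strong duality *)

Lemma mixed_integer_dual_ub {R : realType} n d m
    (f : 'rV[R]_(n + d) -> R) (g : 'rV[R]_(n + d) -> 'cV[R]_m) p aU :
  (forall j, g (mipoint p) j 0 <= 0) -> dual_feasible f g aU ->
  aU.1 <= f (mipoint p).
Proof.
move=> gp [U0 [pi piP]].
(* A nonpositive aggregate rules out the second alternative at a feasible point. *)
have : row_aggr aU.2 g (pi p) (mipoint p) <= 0.
  by apply: sumr_le0 => j _; rewrite mulr_ge0_le0.
by have := piP p; lra.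
Qed.

Lemma feasible_min {R : realType} n d m
    (f : 'rV[R]_(n + d) -> R) (g : 'rV[R]_(n + d) -> 'cV[R]_m) :
  cvx_fun f -> mifeasible g !=set0 -> compact (mifeasible g) ->
  exists p, (forall j, g (mipoint p) j 0 <= 0) /\
    forall q, (forall j, g (mipoint q) j 0 <= 0) -> f (mipoint p) <= f (mipoint q).
Proof.
move=> fc F0 Fcpt.
have [|c] := @EVT_min_rV _ _ f _ F0 Fcpt.
  by apply: continuous_subspaceT; exact: cvx_continuous.
rewrite inE => -[[p _ <-] gp] cmin; exists p; split=> // q gq.
by apply: cmin; rewrite inE; split=> //; exists q.
Qed.

Theorem theorem7 (R : realType) (n d m : nat)
    (f : 'rV[R]_(n + d) -> R) (g : 'rV[R]_(n + d) -> 'cV[R]_m)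
    (f_convex : convex_function [set: 'rV[R]_(n + d)] f)
    (g_convex : convex_cvec g)
    (feasible_neq0 : mifeasible g !=set0)
    (feasible_compact : compact (mifeasible g))
    (g_slater : mi_slater g) :
  exists v : R,
    is_min [set f x | x in mifeasible g] v /\
    is_max [set aU.1 | aU in dual_feasible f g] v.
Proof.
have fc := convex_function_cvx f f_convex.
have gc j := convex_function_cvx _ (g_convex j).
have [p [gp pmin]] := feasible_min n d m f g fc feasible_neq0 feasible_compact.
exists (f (mipoint p)); split.
  split; first by exists (mipoint p) => //; split=> //; exists p.
  by move=> _ [_ [[q _ <-] gq] <-]; exact: pmin.
split; last by move=> _ [aU aUP <-]; exact: mixed_integer_dual_ub aUP.
have [y gy] : exists y, forall j, g (mipoint (p.1, y)) j 0 < 0.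
  by apply: (g_slater p.1 p.2); rewrite -surjective_pairing.
have [B [_ FB]] := compact_bounded feasible_compact.
(* [compact_bounded] bounds norms by any number above [B], such as [|B| + 1]. *)
have [|M0 gM0] := mi_sublevel_bounded n d m g (p.1, y) (`|B| + 1) gc gy.
  move=> q gq i; apply: le_trans (mx_entry_le_norm _ _ _) _.
  apply: (FB (`|B| + 1)); last by split=> //; exists q.
  by have := ler_norm B; lra.
have gM x : (forall j, g x j 0 <= 1) ->
    forall i, `|x 0 i| <= (Num.truncn M0).+1%:R.
  by move=> gx i; apply: le_trans (gM0 x gx i) _; exact: ltW (truncnS_gt _).
have [I [u [u0 cov]]] := finite_certificates f g fc gc (f (mipoint p)) _
  gM g_slater pmin.
have [i z1 z2 w|z|S cardS Scov] :=
    doignon (fun i => fibre_inf (certificate_fun f g (f (mipoint p)) (u i))).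
- apply: (fibre_inf_midconvex _ _ (-1)); first exact: certificate_fun_cvx.
  by move=> x; rewrite /certificate_fun le_max lexx orbT.
- by have [i /certifiesP] := cov z; exists i.
(* Covering the fibre over 0 provides an index [i0], the default of [nth], which fills the remaining
   rows when [S] has fewer than [2 ^ n] elements. *)
have [i0 _] := cov 0.
pose s (k : 'I_(2 ^ n)) := nth i0 (enum S) k.
exists (f (mipoint p), \matrix_(k, j) u (s k) j) => //; split=> [k j|].
  by rewrite mxE.
have row (q : 'rV[int]_n * 'rV[R]_d) : exists k : 'I_(2 ^ n),
    certifies f g (f (mipoint p)) (u (s k)) q.1.
  have [i iS /certifiesP iq] := Scov q.1.
  have lt_i : (index i (enum S) < 2 ^ n)%N.
    by apply: leq_trans cardS; rewrite cardE index_mem mem_enum.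
  by exists (Ordinal lt_i); rewrite /s /= nth_index ?mem_enum.
have [pi piP] := choice row; exists pi => q /=.
have -> : row_aggr (\matrix_(k, j) u (s k) j) g (pi q) (mipoint q) =
    \sum_j u (s (pi q)) j * g (mipoint q) j 0.
  by apply: eq_bigr => j _; rewrite mxE.
by apply: piP; exists q.2 => //; rewrite -surjective_pairing.
Qed.
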